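(* Let $\lambda$ be a scalar and let $B$ be a basis which provides an optimal solution for $\mathcal{P}(0)$, with $E_B=A_B^{-1}D_B$. Then $B$ provides a feasible solution for $\mathcal{P}(\lambda)$ if the following three conditions are satisfied: (i) $\lVert\lambda E_B\rVert_\infty<1$; (ii) $I+\lambda E_B$ is not singular; (iii) $\displaystyle\frac{\lvert\lambda\rvert\,\lVert E_Bx_B(0)\rVert_\infty}{1-\lvert\lambda\rvert\,\lVert E_B\rVert_\infty}\le (x_B(0))_i$ for all $i$.
   Context: Let $A, D \in \mathbb{R}^{m\times n}$, $b\in\mathbb{R}^m$, $c\in\mathbb{R}^n$, and for $\lambda\in\mathbb{R}$ let $\mathcal{P}(\lambda)$ be the linear program $\min\{c^T x : Ax+\lambda Dx=b,\ x\ge 0\}$. A basis $B$ is a choice of $m$ column indices such that $A_B$ is invertible; $M_B$ denotes the submatrix of a matrix $M$ formed by the columns indexed by $B$. Whenever $A_B+\lambda D_B$ is invertible (equivalently $I+\lambda E_B$ is invertible), $x_B(\lambda) = (A_B+\lambda D_B)^{-1}b$. The basis $B$ provides a feasible (resp. optimal) solution for $\mathcal{P}(\lambda)$ if $A_B+\lambda D_B$ is invertible and the vector with basic part $x_B(\lambda)$ and nonbasic part $0$ is feasible for (resp. an optimal solution of) $\mathcal{P}(\lambda)$. For matrices, $\lVert\cdot\rVert_\infty$ is the matrix norm induced by the infinity vector norm (maximum absolute row sum); on a column vector it is the maximum absolute entry. *)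

(* Defs.v *)
From HB Require Import structures.
From mathcomp Require Import all_boot all_order all_algebra.
From mathcomp Require Import all_classical all_reals all_analysis.

Set Implicit Arguments.
Unset Strict Implicit.
Unset Printing Implicit Defensive.

Import Order.TTheory GRing.Theory Num.Theory.
Import numFieldNormedType.Exports.

Local Open Scope classical_set_scope.
Local Open Scope ring_scope.

(* On column vectors the library norm [`|x|] is the maximum absolute entry.
   On matrices it is the entrywise maximum as well, which is not the induced
   norm: for matrices we use the norm induced by [`|x|] on column vectors. *)
Definition mxnorm_oo (R : realType) (m n : nat) (M : 'M[R]_(m, n)) : R :=
  sup [set `|M *m x| | x in [set x : 'cV[R]_n | `|x| <= 1]].

Lemma mxnorm_oo_rowsum (R : realType) (m n : nat) (M : 'M[R]_(m, n)) :
  mxnorm_oo M = \big[Num.max/0]_(i < m) \sum_(j < n) `|M i j|.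
Proof.
set s := \big[_/_]_(_ < _) _.
have cE p (x : 'cV[R]_p) i : `|x i 0| <= `|x|.
  by rewrite [leRHS]/Num.Def.normr /= mx_normrE; apply/bigmax_geP; right; exists (i, 0).
have cB p (x : 'cV[R]_p) (a : R) : 0 <= a -> (forall i, `|x i 0| <= a) -> `|x| <= a.
  move=> a0 xa; rewrite [leLHS]/Num.Def.normr /= mx_normrE.
  by apply/bigmax_leP; split => // -[i j] _ /=; rewrite ord1.
have s0 : 0 <= s by exact: bigmax_ge_id.
have us : ubound [set `|M *m x| | x in [set x : 'cV[R]_n | `|x| <= 1]] s.
  move=> _ [x /= x1 <-]; apply: cB => // i.
  have : \sum_(j < n) `|M i j| <= s by exact: (le_bigmax _ _ i).
  apply: le_trans; rewrite mxE; apply: (le_trans (ler_norm_sum _ _ _)).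
  apply: ler_sum => j _; rewrite normrM ler_piMr //.
  exact: le_trans (cE _ _ _) x1.
have ne : [set `|M *m x| | x in [set x : 'cV[R]_n | `|x| <= 1]] !=set0.
  by exists `|M *m (0 : 'cV_n)|; exists 0 => //=; rewrite normr0.
apply/eqP; rewrite eq_le ge_sup //=.
apply/bigmax_leP; split=> [|i _].
  apply: ub_le_sup; first by exists s.
  by exists 0 => /=; rewrite ?mulmx0 normr0.
pose x : 'cV[R]_n := \col_j Num.sg (M i j).
have x1 : `|x| <= 1.
  by apply: cB => // j; rewrite mxE normr_sg lern1 leq_b1.
apply: (@le_trans _ _ `|M *m x|); last first.
  by apply: ub_le_sup; [exists s | exists x].
apply: le_trans (cE _ _ i); rewrite mxE; apply: le_trans (ler_norm _).
by apply: ler_sum => j _; rewrite mxE normrEsg mulrC.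
Qed.

Section ParametricLP.
Context (R : realType) (m n : nat).
Variables (A D : 'M[R]_(m, n)) (b : 'cV[R]_m) (c : 'cV[R]_n).

Definition feasible (lambda : R) (x : 'cV[R]_n) : Prop :=
  A *m x + lambda *: (D *m x) = b /\ forall j, 0 <= x j 0.

Definition cost (x : 'cV[R]_n) : R := (c^T *m x) 0 0.

Definition optimal (lambda : R) (x : 'cV[R]_n) : Prop :=
  feasible lambda x /\ forall y, feasible lambda y -> cost x <= cost y.

(* A choice of [m] column indices is an injection ['I_m -> 'I_n], in any
   order; [colsub B M] is the submatrix M_B. *)
Definition is_basis (B : 'I_m -> 'I_n) : Prop :=
  injective B /\ colsub B A \in unitmx.

Variable B : 'I_m -> 'I_n.

Definition basis_mx (lambda : R) : 'M[R]_m :=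
  colsub B A + lambda *: colsub B D.

Definition E_mx : 'M[R]_m := invmx (colsub B A) *m colsub B D.

(* Meaningful only when [basis_mx lambda] is invertible, since [invmx] is the
   identity on singular matrices. *)
Definition basic_part (lambda : R) : 'cV[R]_m := invmx (basis_mx lambda) *m b.

Definition extend_basic (v : 'cV[R]_m) : 'cV[R]_n :=
  \col_j (if [pick i | B i == j] is Some i then v i 0 else 0).

Definition provides_feasible (lambda : R) : Prop :=
  basis_mx lambda \in unitmx /\
  feasible lambda (extend_basic (basic_part lambda)).

Definition provides_optimal (lambda : R) : Prop :=
  basis_mx lambda \in unitmx /\
  optimal lambda (extend_basic (basic_part lambda)).

End ParametricLP.

(* Main.v *)
Require Import Defs.
From HB Require Import structures.
From mathcomp Require Import all_boot all_order all_algebra.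
From mathcomp Require Import all_classical all_reals all_analysis.

Import Order.TTheory GRing.Theory Num.Theory.
Import numFieldNormedType.Exports.

Local Open Scope ring_scope.

(** Factoring [A_B + lambda D_B = A_B (I + lambda E)] shows that the new basis
    matrix is invertible and that the new basic part [y] solves
    [(I + lambda E) y = x], where [x] is the basic part at [0].  Its variation
    [d = y - x] is therefore a fixed point: [d = - lambda (E x + E d)].  Taking
    norms, [|d| <= |lambda| |E x| + |lambda| |E| |d|], and since
    [|lambda| |E| < 1] this bounds [|d|] by the quotient in the hypothesis
    [bound] ([fixpoint_norm_le]).  So no entry of [x] drops by more than its own
    value, and [y] is nonnegative.  The equality constraints hold because
    padding [y] with zeros turns multiplication by [M] into multiplication by
    [M_B] ([mulmx_extend_basic]). *)

Lemma normr_col_entry_le (R : realType) (m : nat) (x : 'cV[R]_m) (i : 'I_m) :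
  `|x i 0| <= `|x|.
Proof.
rewrite [leRHS]/Num.Def.normr /= mx_normrE.
by apply/bigmax_geP; right; exists (i, 0).
Qed.

Lemma normr_col_le (R : realType) (m : nat) (x : 'cV[R]_m) (a : R) :
  0 <= a -> (forall i, `|x i 0| <= a) -> `|x| <= a.
Proof.
move=> a0 xa; rewrite [leLHS]/Num.Def.normr /= mx_normrE.
by apply/bigmax_leP; split => // -[i j] _ /=; rewrite ord1.
Qed.

Lemma mxnorm_oo_ge0 (R : realType) (m n : nat) (M : 'M[R]_(m, n)) :
  0 <= mxnorm_oo M.
Proof. by rewrite mxnorm_oo_rowsum; exact: bigmax_ge_id. Qed.

Lemma normr_mulmx_le (R : realType) (m n : nat) (M : 'M[R]_(m, n))
  (x : 'cV[R]_n) : `|M *m x| <= mxnorm_oo M * `|x|.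
Proof.
apply: normr_col_le => [|i]; first by rewrite mulr_ge0 ?mxnorm_oo_ge0.
rewrite mxE; apply: (le_trans (ler_norm_sum _ _ _)).
apply: (@le_trans _ _ ((\sum_j `|M i j|) * `|x|)).
  rewrite mulr_suml; apply: ler_sum => j _.
  by rewrite normrM ler_wpM2l ?normr_col_entry_le.
by rewrite ler_wpM2r // mxnorm_oo_rowsum; exact: (le_bigmax _ _ i).
Qed.

Lemma mxnorm_ooZ (R : realType) (m n : nat) (a : R) (M : 'M[R]_(m, n)) :
  mxnorm_oo (a *: M) = `|a| * mxnorm_oo M.
Proof.
rewrite !mxnorm_oo_rowsum.
rewrite (big_morph _ (fun x y => maxr_pMr x y (normr_ge0 a)) (mulr0 `|a|)).
apply: eq_bigr => i _; rewrite mulr_sumr.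
by apply: eq_bigr => j _; rewrite mxE normrM.
Qed.

(** The contraction estimate: the contribution [|F| |d|] of [F d] to [|d|] can
    be absorbed into the left-hand side because [F] has norm less than one. *)
Lemma fixpoint_norm_le (R : realType) (m : nat) (F : 'M[R]_m) (u d : 'cV[R]_m) :
  mxnorm_oo F < 1 -> d = u - F *m d -> `|d| <= `|u| / (1 - mxnorm_oo F).
Proof.
move=> F1 dE; rewrite ler_pdivlMr ?subr_gt0 // mulrBr mulr1 lerBlDr.
rewrite {1}dE; apply: (le_trans (ler_normB _ _)).
by rewrite lerD2l mulrC normr_mulmx_le.
Qed.

(** Injectivity makes the preimage chosen by [extend_basic] the only one, so
    that zero-padding is the linear map given by the columns [B] of the
    identity. *)
Lemma extend_basicE (R : realType) (m n : nat) (B : 'I_m -> 'I_n)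
  (v : 'cV[R]_m) :
  injective B -> extend_basic B v = colsub B 1%:M *m v.
Proof.
move=> Binj; apply/colP => j; rewrite !mxE; case: pickP => [i /eqP <-|nB].
  rewrite (bigD1 i) //= !mxE eqxx mul1r big1 ?addr0 // => k ki.
  by rewrite !mxE (inj_eq Binj) eq_sym (negPf ki) mul0r.
by rewrite big1 // => k _; rewrite !mxE eq_sym nB mul0r.
Qed.

Lemma mulmx_extend_basic (R : realType) (m n p : nat) (M : 'M[R]_(p, n))
  (B : 'I_m -> 'I_n) (v : 'cV[R]_m) :
  injective B -> M *m extend_basic B v = colsub B M *m v.
Proof.
by move=> Binj; rewrite extend_basicE // mulmxA mulmx_colsub mulmx1.
Qed.

Lemma basis_mx_factor (R : realType) (m n : nat) (A D : 'M[R]_(m, n))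
  (B : 'I_m -> 'I_n) (lambda : R) :
  colsub B A \in unitmx ->
  basis_mx A D B lambda = colsub B A *m (1%:M + lambda *: E_mx A D B).
Proof.
by move=> AB; rewrite mulmxDr mulmx1 -scalemxAr /E_mx mulKVmx.
Qed.

(** Both sides become [b] after multiplication by [A_B], so the basic part at
    [lambda] solves a system governed by [E] alone. *)
Lemma basic_part_perturbed (R : realType) (m n : nat) (A D : 'M[R]_(m, n))
  (b : 'cV[R]_m) (B : 'I_m -> 'I_n) (lambda : R) :
  colsub B A \in unitmx -> basis_mx A D B lambda \in unitmx ->
  (1%:M + lambda *: E_mx A D B) *m basic_part A D b B lambda
    = basic_part A D b B 0.
Proof.
move=> AB ABl; rewrite -[LHS](mulKmx AB) (mulmxA (colsub B A)) -basis_mx_factor //.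
by rewrite /basic_part mulKVmx // /basis_mx scale0r addr0.
Qed.

Theorem theorem9 (R : realType) (m n : nat) (A D : 'M[R]_(m, n))
  (b : 'cV[R]_m) (c : 'cV[R]_n) (lambda : R) (B : 'I_m -> 'I_n)
  (B_basis : is_basis A B)
  (B_optimal : provides_optimal A D b c B 0)
  (norm_lt1 : mxnorm_oo (lambda *: E_mx A D B) < 1)
  (nonsingular : 1%:M + lambda *: E_mx A D B \in unitmx)
  (bound : forall i : 'I_m,
     `|lambda| * `|E_mx A D B *m basic_part A D b B 0|
       / (1 - `|lambda| * mxnorm_oo (E_mx A D B))
     <= basic_part A D b B 0 i 0) :
  provides_feasible A D b B lambda.
Proof.
have [Binj AB] := B_basis.
set E := E_mx A D B in norm_lt1 nonsingular bound.
have ABl : basis_mx A D B lambda \in unitmx.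
  by rewrite basis_mx_factor // unitmx_mul AB.
split=> //; set y := basic_part A D b B lambda.
set x := basic_part A D b B 0 in bound.
have yx : y + lambda *: (E *m y) = x.
  rewrite /x -(basic_part_perturbed _ _ _ _ _ b _ _ AB ABl).
  by rewrite mulmxDl mul1mx -scalemxAl.
have dE : y - x = - (lambda *: (E *m x)) - (lambda *: E) *m (y - x).
  rewrite -scalemxAl mulmxBr scalerBr -{1}yx opprD addNKr.
  by rewrite opprB addKr.
have y_ge0 i : 0 <= y i 0.
  have : `|(y - x) i 0| <= x i 0.
    apply: le_trans (bound i); apply: (le_trans (normr_col_entry_le _ _ _ _)).
    have := fixpoint_norm_le _ _ _ _ _ norm_lt1 dE.
    by rewrite normrN normrZ mxnorm_ooZ.
  by rewrite !mxE ler_norml => /andP[+ _]; rewrite lerBrDl subrr.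
split=> [|j]; last by rewrite mxE; case: pickP.
rewrite !mulmx_extend_basic // scalemxAl -mulmxDl.
exact: mulKVmx.
Qed.
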